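(* Let $S=(S_{ij})_{i,j\ge 0}$ be the infinite lower-triangular matrix with $S_{ij}=\binom{i}{j} \bmod 2\in\{0,1\}$ (Pascal's triangle mod 2, left-justified; $S_{ij}=0$ for $j>i$). Then $S$ is invertible (as an infinite lower-triangular matrix), and $S^{-1}$ is a $(-1,0,1)$-matrix which has its zero entries in exactly the same positions as $S$. Moreover, for every column $j\ge 0$, the sequence of nonzero entries of column $j$ of $S^{-1}$, read from top to bottom (starting at the diagonal entry), is the Prouhet-Thue-Morse word $t(1,-1)$, i.e. the sequence $\big((-1)^{b(n)}\big)_{n\ge 0}=1,-1,-1,1,-1,1,1,-1,\dots$, where $b(n)$ denotes the sum of the binary digits of $n$.
   Context: Infinite lower-triangular matrices are multiplied in the usual way (each entry of a product is a finite sum). The Prouhet-Thue-Morse word $t(a,b)$ on a two-letter alphabet $\{a,b\}$ is obtained by starting with $a$ and repeatedly appending to the current word its image under switching the letters $a\leftrightarrow b$ ($a$, $ab$, $abba$, $abbabaab$, \dots); $t(1,-1)$ is this word with $a=1$, $b=-1$, which equals $\big((-1)^{b(n)}\big)_{n\ge0}$. *)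

(* Defs.v *)
From mathcomp Require Import all_boot all_order all_algebra.
Set Implicit Arguments.
Unset Strict Implicit.
Unset Printing Implicit Defensive.
Import GRing.Theory.
Local Open Scope ring_scope.

Definition imatrix := nat -> nat -> int.

Definition lower_triangular (A : imatrix) : Prop :=
  forall i j : nat, (i < j)%N -> A i j = 0.

(* Meant for lower-triangular A: there A i k = 0 for k > i, so that the       *)
(* formally infinite sum over k stops at k = i.                               *)
Definition imul (A B : imatrix) : imatrix :=
  fun i j => \sum_(k < i.+1) A i k * B k j.

Definition ione : imatrix := fun i j => (i == j)%:R.

Definition lt_inverse (A B : imatrix) : Prop :=
  [/\ lower_triangular A, lower_triangular B,
      imul A B =2 ione & imul B A =2 ione].

Definition pascal_mod2 : imatrix := fun i j => ('C(i, j) %% 2)%N%:Z.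

(* f lists, in increasing order, exactly the positions of the nonzero terms   *)
(* of c, of which there are then infinitely many.                             *)
Definition enumerates_support (c : nat -> int) (f : nat -> nat) : Prop :=
  {homo f : m n / (m < n)%N} /\
  forall i : nat, c i != 0 <-> exists n : nat, f n = i.

Definition switch (T : eqType) (a b x : T) : T := if x == a then b else a.

Definition tm_prefix (T : eqType) (a b : T) (k : nat) : seq T :=
  iter k (fun w => w ++ map (switch a b) w) [:: a].

(* tm_prefix a b n has length 2 ^ n > n and is a prefix of all later stages,  *)
(* so its n-th letter is the n-th letter of the limit word.                   *)
Definition thue_morse (T : eqType) (a b : T) (n : nat) : T := nth a (tm_prefix a b n) n.

(* The digits of n in positions i >= n vanish, since n < 2 ^ n.               *)
Definition binary_digit_sum (n : nat) : nat :=
  (\sum_(i < n) (n %/ 2 ^ i) %% 2)%N.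

(* Main.v *)
(** Writing [s] for the binary digit sum and [E] for the diagonal matrix with
    entries [(-1) ^ s i], the inverse of [S] is [E S E]: by Lucas' theorem
    modulo 2 the matrix [S] is self-similar under splitting off the last binary
    digit, which reduces [S E S = E] to a 2 x 2 computation.  The support of
    column [j] consists of the numbers whose binary digits dominate those of
    [j]; its [n]-th element is obtained by writing the digits of [n] into the
    positions where [j] has digit 0, so its digit sum is [s n + s j]. *)
Require Import Defs.
From mathcomp Require Import all_boot all_order all_algebra.
From mathcomp Require Import zify ring.
Set Implicit Arguments.
Unset Strict Implicit.
Unset Printing Implicit Defensive.
Import GRing.Theory.
Local Open Scope ring_scope.

(** Pascal's rule applied twice gives C(n+2, k+2) = C(n, k) + 2 C(n, k+1) + C(n, k+2), whose middle
    term vanishes modulo 2; so both parities propagate in steps of two. *)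
Lemma odd_bin_double i j :
  odd 'C(i.*2, j.*2) = odd 'C(i, j) /\ odd 'C(i.*2, j.*2.+1) = false.
Proof.
elim: i j => [|i IH] [|j].
- by [].
- by [].
- by rewrite doubleS !bin0 bin1 /= odd_double.
have [e1 o1] := IH j; have [e2 o2] := IH j.+1.
rewrite !doubleS in e2 o2 *.
by rewrite !binS !oddD e1 o1 e2 o2 !addbF !addFb addbb addbC.
Qed.

(** Lucas' theorem modulo 2 for the last digit: [q ==> p] is the parity of C(p, q). *)
Lemma odd_bin_bit i j (p q : bool) :
  odd 'C(p + i.*2, q + j.*2) = (q ==> p) && odd 'C(i, j).
Proof.
have [ev od] := odd_bin_double i j.
case: p; case: q; rewrite /= ?add0n ?add1n //.
  by rewrite binS oddD ev od.
case: j ev od => [|j] ev od; first by rewrite !bin0.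
have [_ od'] := odd_bin_double i j.
by rewrite doubleS binS oddD -doubleS ev od' addbF.
Qed.

Lemma bds_widen n N : (n <= N)%N ->
  binary_digit_sum n = (\sum_(i < N) (n %/ 2 ^ i) %% 2)%N.
Proof.
move=> leN; rewrite /binary_digit_sum.
rewrite (big_ord_widen N (fun i => n %/ 2 ^ i %% 2)%N leN) big_mkcond /=.
apply: eq_bigr => i _; case: ltnP => // le_ni.
by rewrite divn_small // (leq_ltn_trans le_ni) // ltn_expl.
Qed.

Lemma bds_bit (b : bool) n :
  binary_digit_sum (b + n.*2) = (b + binary_digit_sum n)%N.
Proof.
rewrite (@bds_widen (b + n.*2) (b + n.*2).+1) // big_ord_recl expn0 divn1.
rewrite modn2 oddD odd_double addbF oddb; congr addn.
rewrite (@bds_widen n (b + n.*2)); last by lia.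
apply: eq_bigr => i _; rewrite lift0 expnS divnMA; congr (_ %/ _ %% _)%N.
by lia.
Qed.

Lemma bds0 : binary_digit_sum 0 = 0%N.
Proof. by rewrite /binary_digit_sum big_ord0. Qed.

(** The Thue-Morse prefixes grow by a new leading digit, whereas [bds_bit] splits off the last one;
    the induction on [k] passes from one view to the other. *)
Lemma bds_pow2D k m : (m < 2 ^ k)%N ->
  binary_digit_sum (2 ^ k + m) = (binary_digit_sum m).+1.
Proof.
elim: k m => [|k IH] m lt_m.
  have -> : m = 0%N by lia.
  by rewrite bds0 (bds_bit true 0) bds0.
have half_m : (m./2 < 2 ^ k)%N by rewrite expnS in lt_m; lia.
rewrite -{2}[m]odd_double_half bds_bit -addnS -IH // -bds_bit.
congr binary_digit_sum; rewrite expnS; lia.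
Qed.

Definition tm_sign n : int := (-1) ^+ binary_digit_sum n.

Lemma tm_sign_bit (b : bool) n : tm_sign (b + n.*2) = (-1) ^+ b * tm_sign n.
Proof. by rewrite /tm_sign bds_bit exprD. Qed.

Lemma tm_sign_sq n : tm_sign n * tm_sign n = 1.
Proof. by rewrite /tm_sign -signr_odd; case: odd. Qed.

Lemma tm_sign_neq0 n : tm_sign n != 0.
Proof. by rewrite signr_eq0. Qed.

Lemma size_tm_prefix k : size (tm_prefix (1 : int) (-1) k) = (2 ^ k)%N.
Proof.
by elim: k => //= k IH; rewrite size_cat size_map IH expnS mul2n addnn.
Qed.

Lemma nth_tm_prefix k n : (n < 2 ^ k)%N ->
  nth 1 (tm_prefix (1 : int) (-1) k) n = tm_sign n.
Proof.
elim: k n => [|k IH] n lt_n /=.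
  by have -> : n = 0%N by [lia]; rewrite /tm_sign bds0.
rewrite nth_cat size_tm_prefix; case: ltnP => [|le_n]; first exact: IH.
have lt_n' : (n - 2 ^ k < 2 ^ k)%N by rewrite expnS in lt_n; lia.
rewrite (nth_map 1) ?size_tm_prefix // IH //.
(* Index [n] lies in the switched half. On the values 1 and -1, [switch] is negation, which matches
   the extra leading digit 1 of [n]. *)
rewrite -{2}(subnKC le_n) /tm_sign bds_pow2D // exprS -signr_odd.
by case: odd.
Qed.

Lemma thue_morse_sign n : thue_morse 1 (-1) n = tm_sign n.
Proof. by apply: nth_tm_prefix; exact: ltn_expl. Qed.

Lemma pascal_mod2E i j : pascal_mod2 i j = (odd 'C(i, j))%:R.
Proof. by rewrite /pascal_mod2 modn2; case: odd. Qed.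

Lemma pascal_mod2_lt i j : (i < j)%N -> pascal_mod2 i j = 0.
Proof. by move=> lt_ij; rewrite /pascal_mod2 bin_small. Qed.

Lemma pascal_mod2_bit i j (p q : bool) :
  pascal_mod2 (p + i.*2)%N (q + j.*2)%N = (q ==> p)%:R * pascal_mod2 i j.
Proof. by rewrite !pascal_mod2E odd_bin_bit -mulnb natrM. Qed.

Lemma big_ord_double (R : nmodType) (F : nat -> R) n :
  \sum_(k < n.*2) F k = \sum_(k < n) (F (false + k.*2)%N + F (true + k.*2)%N).
Proof.
elim: n => [|n IH]; first by rewrite !big_ord0.
by rewrite doubleS !big_ord_recr /= IH addrA.
Qed.

(** Summing up to a power of two, rather than up to [i], lets the range halve exactly when the last
    digit of [k] is split off. *)
Lemma pascal_sign_pascal_pow2 m i j : (i < 2 ^ m)%N ->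
  \sum_(k < 2 ^ m) pascal_mod2 i k * (tm_sign k * pascal_mod2 k j) =
    (i == j)%:R * tm_sign j.
Proof.
elim: m i j => [|m IH] i j lt_i.
  have -> : i = 0%N by lia.
  rewrite expn0 big_ord1 /=; case: j => [|j]; last first.
    by rewrite [pascal_mod2 _ j.+1]pascal_mod2_lt // !mulr0 mul0r.
  by rewrite pascal_mod2E bin0 mul1r mulr1 mul1r.
rewrite expnS mul2n.
rewrite (big_ord_double (fun k => pascal_mod2 i k * (tm_sign k * pascal_mod2 k j))).
rewrite -[i]odd_double_half -[j]odd_double_half.
set p := odd i; set q := odd j; set a := i./2; set b := j./2.
have lt_a : (a < 2 ^ m)%N by rewrite expnS in lt_i; rewrite /a; lia.
have -> : ((p + a.*2 == q + b.*2) = (p == q) && (a == b))%N.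
  by case: p; case: q; lia.
rewrite -mulnb natrM tm_sign_bit.
transitivity ((p == q)%:R * (-1) ^+ q * ((a == b)%:R * tm_sign b)); last by ring.
rewrite -(IH a b lt_a) big_distrr; apply: eq_bigr => k _.
rewrite !pascal_mod2_bit !tm_sign_bit.
(* Entrywise, this is P D P = D for P with rows (1, 0), (1, 1) and D = diag(1, -1). *)
by case: p; case: q => /=; ring.
Qed.

Lemma pascal_sign_pascal i j :
  \sum_(k < i.+1) pascal_mod2 i k * (tm_sign k * pascal_mod2 k j) =
    (i == j)%:R * tm_sign j.
Proof.
have lt_i : (i < 2 ^ i)%N by exact: ltn_expl.
rewrite -(pascal_sign_pascal_pow2 j lt_i).
pose F k := pascal_mod2 i k * (tm_sign k * pascal_mod2 k j).
rewrite (big_ord_widen _ F lt_i) big_mkcond /=.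
apply: eq_bigr => k _; case: ltnP => // le_ik.
by rewrite pascal_mod2_lt // mul0r.
Qed.

Definition pascal_inv : imatrix :=
  fun i j => tm_sign i * pascal_mod2 i j * tm_sign j.

Lemma pascal_inv_correct : lt_inverse pascal_mod2 pascal_inv.
Proof.
split=> [i j|i j lt_ij|i j|i j]; first exact: pascal_mod2_lt.
- by rewrite /pascal_inv pascal_mod2_lt // mulr0 mul0r.
- rewrite /imul /ione.
  transitivity ((i == j)%:R * tm_sign j * tm_sign j); last first.
    by rewrite -mulrA tm_sign_sq mulr1.
  rewrite -pascal_sign_pascal big_distrl /=.
  by apply: eq_bigr => k _; rewrite /pascal_inv; ring.
rewrite /imul /ione.
transitivity (tm_sign i * ((i == j)%:R * tm_sign j)).
  rewrite -pascal_sign_pascal big_distrr /=.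
  by apply: eq_bigr => k _; rewrite /pascal_inv; ring.
case: eqP => [->|_]; last by rewrite mul0r mulr0.
by rewrite mul1r tm_sign_sq.
Qed.

(** Forward substitution: the last term of the sum in row [i] is the unknown entry itself, and the
    other terms involve earlier rows only. This yields uniqueness of the inverse. *)
Lemma imul_unitriangular_inj (A B C : imatrix) :
  (forall i, A i i = 1) -> imul A B =2 imul A C -> B =2 C.
Proof.
move=> A1 eqBC i j; elim/ltn_ind: i => i IH.
have := eqBC i j; rewrite /imul !big_ord_recr /= A1 !mul1r.
rewrite (eq_bigr (fun k : 'I_i => A i k * C k j)); first exact: addrI.
by move=> k _; rewrite IH.
Qed.

Lemma column_enumeration j : exists f : nat -> nat,
  [/\ {homo f : m n / (m < n)%N},
      forall i, odd 'C(i, j) <-> exists n, f n = i,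
      f 0%N = j
    & forall n, binary_digit_sum (f n) =
                (binary_digit_sum n + binary_digit_sum j)%N].
Proof.
elim/ltn_ind: j => j IH; case: (posnP j) => [->|j_gt0].
  exists id; split=> // [i|n]; last by rewrite bds0 addn0.
  by rewrite bin0; split=> // _; exists i.
have [|f [f_mono f_supp f0 f_bds]] := IH j./2; first by lia.
have odd_binE i : odd 'C(i, j) = (odd j ==> odd i) && odd 'C(i./2, j./2).
  by rewrite -odd_bin_bit !odd_double_half.
have bdsE i : binary_digit_sum i = (odd i + binary_digit_sum i./2)%N.
  by rewrite -bds_bit odd_double_half.
case odd_j: (odd j).
  (* A digit 1 of [j] forces the same digit in [i], so [n] is passed on whole to the remaining
     digits. *)
  exists (fun n => true + (f n).*2)%N; split=> [m n /f_mono|i||n].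
  - by lia.
  - rewrite odd_binE odd_j /=; split=> [/andP[odd_i /f_supp[n fn]]|[n <-]].
      by exists n; rewrite fn; lia.
    apply/andP; split; first by lia.
    by apply/f_supp; exists n; lia.
  - by rewrite f0; lia.
  by rewrite bds_bit f_bds [binary_digit_sum j]bdsE odd_j; lia.
(* A digit 0 of [j] leaves that digit of [i] free: it receives the last digit of [n]. *)
exists (fun n => odd n + (f n./2).*2)%N; split=> [m n lt_mn|i||n].
- have [lt_h|ge_h] := ltnP m./2 n./2; first by have := f_mono _ _ lt_h; lia.
  have -> : m./2 = n./2 by lia.
  by lia.
- rewrite odd_binE odd_j /=; split=> [/f_supp[n fn]|[n <-]].
    exists (odd i + n.*2)%N; rewrite half_bit_double fn oddD odd_double addbF.
    by rewrite oddb odd_double_half.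
  by apply/f_supp; exists n./2; rewrite half_bit_double.
- by rewrite /= f0; lia.
by rewrite bds_bit f_bds [binary_digit_sum j]bdsE [binary_digit_sum n]bdsE odd_j; lia.
Qed.

Theorem theorem1 :
  (exists T : imatrix, lt_inverse pascal_mod2 T) /\
  (forall T : imatrix, lt_inverse pascal_mod2 T ->
    [/\ forall i j : nat, T i j \in [:: -1; 0; 1],
        forall i j : nat, T i j = 0 <-> pascal_mod2 i j = 0
      & forall j : nat, exists f : nat -> nat,
          [/\ enumerates_support (fun i => T i j) f,
              f 0%N = j,
              forall n : nat, T (f n) j = thue_morse 1 (-1) n
            & forall n : nat, T (f n) j = (-1) ^+ binary_digit_sum n]]).
Proof.
split; first by exists pascal_inv; exact: pascal_inv_correct.
move=> T [_ _ ST1 _]; have [_ _ SI1 _] := pascal_inv_correct.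
have TE : T =2 pascal_inv.
  apply: (@imul_unitriangular_inj pascal_mod2) => [i|i j].
    by rewrite pascal_mod2E binn.
  by rewrite ST1 SI1.
have T0 i j : (T i j == 0) = ~~ odd 'C(i, j).
  rewrite TE /pascal_inv !mulf_eq0 !(negPf (tm_sign_neq0 _)) orbF /=.
  by rewrite pascal_mod2E; case: odd.
split=> [i j|i j|j].
- rewrite TE /pascal_inv /tm_sign pascal_mod2E -signr_odd -[in X in _ * X]signr_odd.
  by case: odd; case: odd; case: odd.
- by rewrite (rwP eqP) T0 pascal_mod2E; case: odd.
have [f [f_mono f_supp f0 f_bds]] := column_enumeration j.
have Tf n : T (f n) j = tm_sign n.
  have odd_f : odd 'C(f n, j) by apply/f_supp; exists n.
  (* The sign of row [f n] is [tm_sign n * tm_sign j], and its second factor cancels against the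
     sign of column [j]. *)
  rewrite TE /pascal_inv pascal_mod2E odd_f mulr1 {1}/tm_sign f_bds exprD.
  by rewrite -mulrA tm_sign_sq mulr1.
exists f; split=> // [|n]; last by rewrite thue_morse_sign.
by split=> // i; rewrite T0 negbK.
Qed.
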